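(* Let $k$ be a positive integer. If $G$ is a simple graph with $\operatorname{ex}(G,P_3)<k$, then $e(G)\leq\binom{k}{2}+\mathbf{1}_{k=3}$. Consequently $\mathcal{E}_{P_3}(k)=\binom{k}{2}+\mathbf{1}_{k=3}$.
   Context: $P_3$ denotes the path with 3 edges (4 vertices). Graphs are simple, 2-uniform, without isolated vertices. $\operatorname{ex}(G,H)$ is the maximum number of edges in a subgraph of $G$ containing no copy of $H$, and $\mathcal{E}_H(k):=\sup\{e(G): G\text{ simple}, \operatorname{ex}(G,H)<k\}$. $\mathbf{1}_{k=3}$ equals $1$ if $k=3$ and $0$ otherwise. *)

(* Defs.v *)
(* A (finite, simple) graph without isolated vertices is
   represented by its edge set: a set of 2-element subsets of a finite type. *)
From mathcomp Require Import all_boot.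
Set Implicit Arguments. Unset Strict Implicit. Unset Printing Implicit Defensive.

Definition simple_graph (T : finType) (E : {set {set T}}) : bool :=
  [forall e in E, #|e| == 2].

Definition has_P3 (T : finType) (F : {set {set T}}) : bool :=
  [exists a : T, exists b : T, exists c : T, exists d : T,
     [&& uniq [:: a; b; c; d], [set a; b] \in F, [set b; c] \in F
       & [set c; d] \in F]].

Definition ex_P3 (T : finType) (E : {set {set T}}) : nat :=
  \max_(F : {set {set T}} | (F \subset E) && ~~ has_P3 F) #|F|.

(* Main.v *)
Require Import Defs.
From mathcomp Require Import all_boot.
From mathcomp Require Import zify.

Set Implicit Arguments. Unset Strict Implicit. Unset Printing Implicit Defensive.

(* Write m = k - 1, so that ex(G, P_3) <= m.

   Upper bound, by strong induction on m.  Let v have maximum degree D, let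
   N = N(v), let S be the set of vertices outside the closed neighbourhood of v,
   and r = m - D.  The star at v shows ex(G[S]) <= r, and the star at u in N
   with leaves in S next to the star at v without u shows d_S(u) <= r + 1.
   Adding the degrees over v |: N gives
     2 e(G) <= 2 e(G[S]) + D (D + 1) + D (r + 1),
   which suffices when r > 0.  When r = 0, S is independent and each u in N has
   at most one neighbour in S; it is enough that N has at least as many
   non-adjacent pairs as there are edges from N to S.  As soon as some u with a
   neighbour in S misses only one vertex w of N, packings by a triangle and a
   star force w to be isolated in G[N], which gives enough missing pairs except
   in one configuration; that one either has m = 2 (the 4-cycle) or again
   contains a packing with m + 1 edges.

   Lower bound: the 4-cycle for k = 3, and otherwise K_m with a pendant edge
   attached at every vertex.  The clique K_k itself does not work when 3
   divides k, since it then contains k / 3 disjoint triangles. *)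

(** * Edge sets, neighbourhoods and degrees *)

Definition nbhd (T : finType) (E : {set {set T}}) (x : T) : {set T} :=
  [set y | [set x; y] \in E].

Section Graphs.

Variable T : finType.
Implicit Types (E F : {set {set T}}) (N S W X Y L : {set T}) (u v w x y z : T).

Lemma simple_graphP E :
  reflect (forall e, e \in E -> #|e| = 2) (simple_graph E).
Proof. by apply: (iffP forall_inP) => h e /h /eqP. Qed.

Lemma simple_graphS E F : F \subset E -> simple_graph E -> simple_graph F.
Proof.
by move=> /subsetP sFE /simple_graphP sE; apply/simple_graphP => e /sFE /sE.
Qed.

Lemma has_P3P F :
  reflect (exists a b c d, [/\ uniq [:: a; b; c; d], [set a; b] \in F,
                              [set b; c] \in F & [set c; d] \in F])
          (has_P3 F).
Proof.
apply: (iffP existsP) => [[a /existsP[b /existsP[c /existsP[d /and4P[*]]]]]|].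
  by exists a, b, c, d.
case=> a [b [c [d [*]]]]; exists a; apply/existsP; exists b; apply/existsP.
by exists c; apply/existsP; exists d; apply/and4P.
Qed.

Lemma in_nbhd E x y : (y \in nbhd E x) = ([set x; y] \in E).
Proof. by rewrite inE. Qed.

Lemma nbhd_sym E x y : (y \in nbhd E x) = (x \in nbhd E y).
Proof. by rewrite !inE setUC. Qed.

Lemma nbhd_neq E x y : simple_graph E -> y \in nbhd E x -> x != y.
Proof.
move=> /simple_graphP sE; rewrite inE => /sE; rewrite cards2.
by case: eqP.
Qed.

Lemma nbhdS E F x : F \subset E -> nbhd F x \subset nbhd E x.
Proof. by move=> /subsetP sFE; apply/subsetP => y; rewrite !inE => /sFE. Qed.

Lemma nbhd_induced E S x :
  nbhd (E ::&: S) x = if x \in S then nbhd E x :&: S else set0.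
Proof.
apply/setP => y; rewrite !inE subUset !sub1set.
by case: (x \in S); rewrite ?inE ?andbF.
Qed.

Lemma edgeE E e x : simple_graph E -> e \in E -> x \in e ->
  exists2 y, y \in nbhd E x & e = [set x; y].
Proof.
move=> /simple_graphP sE eE xe; have /eqP /cards2P[a [b [neq_ab eab]]] := sE _ eE.
move: xe eE; rewrite {e}eab !inE => /orP[] /eqP -> abE.
  by exists b; rewrite ?inE.
by exists a; rewrite ?inE setUC.
Qed.

Lemma card_nbhd E x : simple_graph E ->
  #|nbhd E x| = #|[set e in E | x \in e]|.
Proof.
move=> sE; rewrite -(@card_in_imset _ _ (fun y => [set x; y])).
  apply: eq_card => e; rewrite inE; apply/imsetP/andP => [[y]|[eE xe]].
    by rewrite inE => xyE ->; rewrite !inE eqxx.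
  by have [y xy ->] := edgeE sE eE xe; exists y.
move=> y z /= /(nbhd_neq sE) xy /(nbhd_neq sE) xz /setP/(_ y).
by rewrite !inE eqxx orbT eq_sym (negPf xy) /= => /esym/eqP.
Qed.

Lemma handshake E : simple_graph E -> \sum_x #|nbhd E x| = 2 * #|E|.
Proof.
move=> sE.
transitivity (\sum_x \sum_(e in E) (x \in e : nat)).
  apply: eq_bigr => x _; rewrite card_nbhd // -sum1_card big_mkcond /=.
  rewrite [RHS]big_mkcond /=; apply: eq_bigr => e _; rewrite inE.
  by case: (e \in E); case: (x \in e).
rewrite exchange_big mulnC -sum_nat_const; apply: eq_bigr => e eE.
by rewrite -(simple_graphP _ sE e eE) -sum1_card [RHS]big_mkcond.
Qed.

(** * The extremal number, and packings of stars and triangles *)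

Lemma ex_P3_ge E F : F \subset E -> ~~ has_P3 F -> #|F| <= ex_P3 E.
Proof.
by move=> sFE nF; rewrite /ex_P3 (@leq_bigmax_cond _ _ (fun F => #|F|)) ?sFE.
Qed.

Lemma ex_P3_attained E :
  exists F, [/\ F \subset E, ~~ has_P3 F & #|F| = ex_P3 E].
Proof.
have P0 : 0 < #|[pred F : {set {set T}} | (F \subset E) && ~~ has_P3 F]|.
  apply/card_gt0P; exists set0; rewrite inE sub0set.
  by apply/has_P3P => -[a [b [c [d []]]]]; rewrite inE.
have [F /andP[sFE nF] eF] := eq_bigmax_cond (fun F : {set {set T}} => #|F|) P0.
by exists F.
Qed.

Lemma induced_sub E S : E ::&: S \subset E.
Proof. by apply/subsetP => e; rewrite inE => /andP[]. Qed.

(** Consecutive edges of a path share a vertex, so a path in the union of two vertex-disjoint graphs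
    stays inside one of them. *)
Lemma ex_P3_superadd E X Y : simple_graph E -> [disjoint X & Y] ->
  ex_P3 (E ::&: X) + ex_P3 (E ::&: Y) <= ex_P3 E.
Proof.
move=> sE dXY.
have [F [/subsetP sF nF <-]] := ex_P3_attained (E ::&: X).
have [G [/subsetP sG nG <-]] := ex_P3_attained (E ::&: Y).
have FX a b : [set a; b] \in F -> (a \in X) * (b \in X).
  by move=> /sF; rewrite !inE subUset !sub1set => /and3P[_ -> ->].
have GY a b : [set a; b] \in G -> (a \in Y) * (b \in Y).
  by move=> /sG; rewrite !inE subUset !sub1set => /and3P[_ -> ->].
have nXY a : a \in X -> a \in Y -> False.
  by move=> aX aY; move: (disjointFr dXY aX); rewrite aY.
have FG0 : F :&: G = set0.
  apply/setP => e; rewrite inE in_set0; apply/negP => /andP[eF eG].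
  have := simple_graphP _ sE e; have := sF _ eF; rewrite inE => /andP[eE _].
  move=> /(_ eE) /eqP /cards2P[a [b [_ eab]]]; subst e.
  exact: nXY (FX _ _ eF).1 (GY _ _ eG).1.
rewrite -[leqLHS]subn0 -(@cards0 {set T}) -FG0 -cardsU; apply: ex_P3_ge.
  apply/subsetP => e; rewrite inE => /orP[/sF|/sG].
    by rewrite inE => /andP[].
  by rewrite inE => /andP[].
have stepF a b c : [set a; b] \in F -> [set b; c] \in F :|: G ->
    [set b; c] \in F.
  by move=> /FX[_ bX]; rewrite inE => /orP[//|/GY[bY _]]; case: (nXY b).
have stepG a b c : [set a; b] \in G -> [set b; c] \in F :|: G ->
    [set b; c] \in G.
  by move=> /GY[_ bY]; rewrite inE => /orP[/FX[bX _]|//]; case: (nXY b).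
apply/has_P3P => -[a [b [c [d [u]]]]]; rewrite inE => /orP[ab bc cd|ab bc cd].
  have bcF := stepF _ _ _ ab bc; have cdF := stepF _ _ _ bcF cd.
  by case/has_P3P: nF; exists a, b, c, d.
have bcG := stepG _ _ _ ab bc; have cdG := stepG _ _ _ bcG cd.
by case/has_P3P: nG; exists a, b, c, d.
Qed.

(** The two end edges of a [P_3] are disjoint, while all edges of a star meet in its centre. *)
Lemma ex_P3_star E x L : simple_graph E -> L \subset nbhd E x ->
  #|L| <= ex_P3 (E ::&: (x |: L)).
Proof.
move=> sE /subsetP sL; pose st := [set [set x; y] | y in L].
have <- : #|st| = #|L|.
  apply: card_in_imset => y z /sL /(nbhd_neq sE) xy _ /setP/(_ y).
  by rewrite !inE eqxx orbT eq_sym (negPf xy) => /esym/eqP.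
apply: ex_P3_ge.
  apply/subsetP => _ /imsetP[y yL ->]; rewrite !inE subUset !sub1set !inE eqxx.
  by rewrite yL orbT andbT -in_nbhd sL.
apply/has_P3P => -[a [b [c [d [u ab _ cd]]]]].
have stx e : e \in st -> x \in e by case/imsetP=> y _ ->; rewrite !inE eqxx.
move: u (stx _ ab) (stx _ cd); rewrite /= !inE.
by move=> u /orP[] /eqP xe /orP[] /eqP xe'; move: u;
  rewrite -xe -xe' eqxx ?orbT ?andbF.
Qed.

(** A [P_3] needs four vertices and a triangle has three. *)
Lemma ex_P3_triangle E x y z : simple_graph E ->
  y \in nbhd E x -> z \in nbhd E y -> z \in nbhd E x ->
  3 <= ex_P3 (E ::&: [set x; y; z]).
Proof.
move=> sE xy yz xz; have nxy := nbhd_neq sE xy; have nyz := nbhd_neq sE yz.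
have nxz := nbhd_neq sE xz.
pose F := [set [set x; y]; [set y; z]; [set x; z]].
have <- : #|F| = 3.
  rewrite /F setUC cardsU1 cards2 !inE.
  have -> : [set x; y] != [set y; z].
    by apply/eqP => /setP/(_ x); rewrite !inE eqxx (negPf nxy) (negPf nxz).
  have /negPf -> : [set x; z] != [set x; y].
    apply/eqP => /setP/(_ z); rewrite !inE eqxx orbT eq_sym (negPf nxz) /=.
    by rewrite eq_sym (negPf nyz).
  have /negPf -> // : [set x; z] != [set y; z].
  by apply/eqP => /setP/(_ x); rewrite !inE eqxx (negPf nxy) (negPf nxz).
apply: ex_P3_ge.
  apply/subsetP => e; rewrite !inE => /orP[/orP[]|] /eqP ->;
  by rewrite -in_nbhd ?xy ?yz ?xz subUset !sub1set !inE !eqxx ?orbT.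
apply/has_P3P => -[a [b [c [d [u ab _ cd]]]]].
have FX e : e \in F -> e \subset [set x; y; z].
  by rewrite !inE => /orP[/orP[]|] /eqP ->; rewrite subUset !sub1set !inE !eqxx ?orbT.
have /subset_leq_card : [set a; b] :|: [set c; d] \subset [set x; y; z].
  by rewrite subUset !FX.
move: u; rewrite /= !inE !negb_or andbT => /and3P[/and3P[nab nac nad]].
move=> /andP[nbc nbd] ncd; rewrite cardsU (_ : _ :&: _ = set0) ?cards0.
  rewrite !cards2 nab ncd cardsU cards1 cards2 leqNgt.
  by rewrite (leq_ltn_trans (leq_subr _ _)) //; case: (_ != _).
apply/setP => t; rewrite !inE; apply/negP => /andP[].
by case/orP=> /eqP ->; apply/negP; rewrite negb_or ?nac ?nad ?nbc ?nbd.
Qed.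

(** * The upper bound *)

Lemma ex_P3S E F : F \subset E -> ex_P3 F <= ex_P3 E.
Proof.
move=> sFE; have [H [sHF nH <-]] := ex_P3_attained F.
exact: ex_P3_ge (subset_trans sHF sFE) nH.
Qed.

Lemma ex_P3_eq0 E : simple_graph E -> ex_P3 E = 0 -> E = set0.
Proof.
move=> sE ex0; apply/setP => e; rewrite in_set0; apply/negP => eE.
have /eqP /cards2P[a [b [_ eab]]] := simple_graphP _ sE e eE.
have := @ex_P3_star E a [set b] sE; rewrite sub1set in_nbhd -eab => /(_ eE).
by rewrite cards1 => /leq_trans/(_ (ex_P3S (induced_sub _ _))); rewrite ex0.
Qed.

(** Degrees outside [W] count the inner edges twice and each edge to [W] once; the latter are
    recounted from their ends in [W]. *)
Lemma double_count_edges E W : simple_graph E ->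
  2 * #|E| = 2 * #|E ::&: ~: W| +
             \sum_(x in W) (#|nbhd E x| + #|nbhd E x :\: W|).
Proof.
move=> sE; have sES := simple_graphS (induced_sub E (~: W)) sE.
rewrite -!handshake // (bigID (mem W)) /= [in RHS]big_split /= [RHS]addnCA.
congr (_ + _).
transitivity (\sum_(x | x \notin W)
   (#|nbhd E x :\: W| + #|nbhd E x :&: W|)).
  by apply: eq_bigr => x _; rewrite addnC cardsID.
rewrite big_split /=; congr (_ + _).
  rewrite big_mkcond; apply: eq_bigr => x _; rewrite nbhd_induced inE setDE.
  by case: ifP; rewrite ?cards0.
under eq_bigr => x _ do rewrite -sum1_card.
rewrite (exchange_big_dep (mem W)) /=.
2: by move=> x y _; rewrite inE => /andP[].
apply: eq_bigr => y yW; rewrite -sum1_card; apply: eq_bigl => x.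
by rewrite !inE yW andbT setUC.
Qed.

(** * Edges leaving the closed neighbourhood of a vertex *)

Lemma nbhd_lone_nonneighbour E u w N :
  N :\ u :\: nbhd E u = [set w] -> N :\ u :\ w \subset nbhd E u.
Proof.
move=> missE; apply/subsetP => y; rewrite !inE => /and3P[yw yu yN].
move/setP/(_ y): missE; rewrite !inE yu yN (negPf yw) !andbT.
by move=> /negbFE.
Qed.

Lemma outside_bound E v u : simple_graph E -> u \in nbhd E v ->
  #|nbhd E u :\: (v |: nbhd E v)| + #|nbhd E v| <= (ex_P3 E).+1.
Proof.
move=> sE uN; set N := nbhd E v.
have star_u := ex_P3_star sE (subsetDl (nbhd E u) (v |: N)).
have star_v := ex_P3_star sE (subsetDl N [set u]).
have dis : [disjoint u |: (nbhd E u :\: (v |: N)) & v |: (N :\ u)].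
  apply/pred0P => t /=; rewrite !inE; apply/negP => /andP[+ /orP[]].
    by move=> + /eqP tE; rewrite tE eqxx /= orbF (negPf (nbhd_neq sE uN)).
  by move=> + /andP[tu tN]; rewrite (negPf tu) tN orbT.
have := ex_P3_superadd sE dis; have := cardsD1 u N; rewrite uN; lia.
Qed.

(* Otherwise the triangle [w v z] and the star centred at [u] covering [x] and
   the rest of [N] together have [#|N| + 1] edges. *)
Lemma lone_nonneighbour E v u w x z (N := nbhd E v) :
  simple_graph E -> ex_P3 E <= #|N| -> u \in N -> z \in N ->
  N :\ u :\: nbhd E u = [set w] -> x \in nbhd E u :\: (v |: N) ->
  z != u -> z != w -> z \notin nbhd E w.
Proof.
move=> sE exE uN zN missE xS zu zw; apply/negP => wz.
have /setDP[/setD1P[wu wN] _] : w \in N :\ u :\: nbhd E u by rewrite missE set11.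
move: xS; rewrite !inE negb_or => /andP[/andP[xv xN] ux].
have vu := nbhd_neq sE uN; have vw := nbhd_neq sE wN; have vz := nbhd_neq sE zN.
have [xu xw xz] : [/\ x != u, x != w & x != z].
  by split; apply: contraNneq xN => ->; rewrite -in_nbhd.
have vN : v \notin N by apply/negP => /(nbhd_neq sE); rewrite eqxx.
pose L := x |: (N :\ u :\ w :\ z).
have sL : L \subset nbhd E u.
  rewrite subUset sub1set in_nbhd ux (subset_trans (subsetDl _ _)) //.
  exact: nbhd_lone_nonneighbour.
have star_u := ex_P3_star sE sL.
have vw' : v \in nbhd E w by rewrite nbhd_sym.
have tri := ex_P3_triangle sE vw' zN wz.
have cL : #|N| <= #|L| + 2.
  rewrite cardsU1 !inE (negPf xN) !andbF.
  have := cardsD1 u N; have := cardsD1 w (N :\ u).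
  have := cardsD1 z (N :\ u :\ w); rewrite !inE -!in_nbhd -/N uN wN zN wu zu zw /=.
  clear; lia.
have dis : [disjoint u |: L & [set w; v; z]].
  apply/pred0P => t /=; rewrite !inE; apply/negP => /andP[+ /orP[/orP[]|]].
  - by move=> + /eqP tE; rewrite tE eqxx /= !andbF orbF (negPf wu) eq_sym (negPf xw).
  - move=> + /eqP tE; rewrite tE (negPf vu) eq_sym (negPf xv) /=.
    by rewrite -in_nbhd (negPf vN) !andbF.
  - by move=> + /eqP tE; rewrite tE eqxx /= (negPf zu) eq_sym (negPf xz).
have := ex_P3_superadd sE dis; move: exE star_u tri cL; clear; lia.
Qed.

(* Otherwise the star centred at [u] covering [v], [x] and [N] minus [u], [w],
   together with the edge [w y], has [#|N| + 1] edges. *)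
Lemma lone_nonneighbour_outside E v u w x y (N := nbhd E v) :
  simple_graph E -> ex_P3 E <= #|N| -> u \in N ->
  N :\ u :\: nbhd E u = [set w] -> x \in nbhd E u :\: (v |: N) ->
  y \in nbhd E w :\: (v |: N) -> x = y.
Proof.
move=> sE exE uN missE xS yS; apply/eqP; apply: contraT => xy.
have /setDP[/setD1P[wu wN] _] : w \in N :\ u :\: nbhd E u by rewrite missE set11.
move: xS yS; rewrite !inE !negb_or => /andP[/andP[xv xN] ux] /andP[/andP[yv yN] wy].
have vu := nbhd_neq sE uN; have vw := nbhd_neq sE wN.
have [xu xw] : x != u /\ x != w.
  by split; apply: contraNneq xN => ->; rewrite -in_nbhd.
have [yu yw] : y != u /\ y != w.
  by split; apply: contraNneq yN => ->; rewrite -in_nbhd.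
pose L := x |: (v |: (N :\ u :\ w)).
have sL : L \subset nbhd E u.
  by rewrite !subUset !sub1set in_nbhd ux nbhd_sym uN nbhd_lone_nonneighbour.
have star_u := ex_P3_star sE sL.
have star_w : #|[set y]| <= ex_P3 (E ::&: (w |: [set y])).
  by apply: ex_P3_star; rewrite // sub1set in_nbhd.
rewrite cards1 in star_w.
have vN : v \notin N by apply/negP => /(nbhd_neq sE); rewrite eqxx.
have cL : #|N| <= #|L|.
  rewrite !cardsU1 !inE -!in_nbhd -/N (negPf vN) (in_nbhd E v x) (negPf xN) !andbF (negPf xv).
  have := cardsD1 u N; have := cardsD1 w (N :\ u).
  rewrite !inE -!in_nbhd -/N uN wN wu /=; clear; lia.
have dis : [disjoint u |: L & w |: [set y]].
  apply/pred0P => t /=; rewrite !inE; apply/negP => /andP[+ /orP[]].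
  - move=> + /eqP tE; rewrite tE eqxx /= (negPf wu) eq_sym (negPf xw) /=.
    by rewrite orbF eq_sym (negPf vw).
  - move=> + /eqP tE; rewrite tE (negPf yu) eq_sym (negPf xy) (negPf yv) /=.
    by rewrite (negPf yN) !andbF.
have := ex_P3_superadd sE dis; move: exE star_u star_w cL; clear; lia.
Qed.

(* Otherwise the triangle [x u z] and the star centred at [v] covering the rest
   of [N] together have [#|N| + 1] edges. *)
Lemma outside_disjoint E v u z x (N := nbhd E v) :
  simple_graph E -> ex_P3 E <= #|N| -> u \in N -> z \in N ->
  z \in nbhd E u -> x \in nbhd E u :\: (v |: N) ->
  x \notin nbhd E z :\: (v |: N).
Proof.
move=> sE exE uN zN uz; rewrite !inE !negb_or => /andP[/andP[xv xN] ux].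
rewrite xv xN /= -in_nbhd; apply/negP => zx.
have vu := nbhd_neq sE uN; have vz := nbhd_neq sE zN; have nuz := nbhd_neq sE uz.
have [xu xz] : x != u /\ x != z.
  by split; apply: contraNneq xN => ->; rewrite -in_nbhd.
have ux' : u \in nbhd E x by rewrite nbhd_sym in_nbhd.
have tri := ex_P3_triangle sE ux' uz (_ : z \in nbhd E x).
have {}tri := tri (etrans (nbhd_sym _ _ _) zx).
have sL : N :\ u :\ z \subset nbhd E v by rewrite (subset_trans (subsetDl _ _)) ?subsetDl.
have star_v := ex_P3_star sE sL.
have cL : #|N| = #|N :\ u :\ z| + 2.
  have := cardsD1 u N; have := cardsD1 z (N :\ u).
  rewrite !inE -!in_nbhd -/N uN zN eq_sym nuz /=; clear; lia.
have dis : [disjoint v |: (N :\ u :\ z) & [set x; u; z]].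
  apply/pred0P => t /=; rewrite !inE; apply/negP => /andP[+ /orP[/orP[]|]].
  - by move=> + /eqP tE; rewrite tE (negPf xv) (negPf xN) !andbF.
  - by move=> + /eqP tE; rewrite tE eqxx andbF eq_sym (negPf vu).
  - by move=> + /eqP tE; rewrite tE eqxx orbF eq_sym (negPf vz).
have := ex_P3_superadd sE dis; move: exE star_v tri cL; clear; lia.
Qed.

(** [nbhd E u] splits into [v], a part inside [N] and a part outside [v |: N]; the first two have
    [#|N|] elements minus the vertices of [N :\ u] not adjacent to [u]. *)
Lemma degree_nonneighbours E v u (N := nbhd E v) : simple_graph E -> u \in N ->
  #|nbhd E u| + #|N :\ u :\: nbhd E u| = #|N| + #|nbhd E u :\: (v |: N)|.
Proof.
move=> sE uN.
have vN : v \notin N by apply/negP => /(nbhd_neq sE); rewrite eqxx.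
have uu : u \notin nbhd E u by apply/negP => /(nbhd_neq sE); rewrite eqxx.
rewrite -(cardsID (v |: N) (nbhd E u)).
have -> : nbhd E u :&: (v |: N) = v |: ((N :\ u) :&: nbhd E u).
  apply/setP => t; rewrite !(in_setI, in_setU1, in_setD1).
  case: (eqVneq t v) => [->|_] /=; first by rewrite nbhd_sym uN.
  by case: (eqVneq t u) => [->|_] /=; [rewrite (negPf uu) | rewrite andbC].
rewrite cardsU1 !(in_setI, in_setD1) (negPf vN) andbF.
have := cardsID (nbhd E u) (N :\ u); have := cardsD1 u N; rewrite uN; clear; lia.
Qed.

(** The right-hand sum counts each missing pair of [N] twice. The slack of one is harmless, since it
    is later absorbed by the parity of [2 e(G)]. *)
Lemma sum_nonneighbours E v (N := nbhd E v) :
  simple_graph E -> ex_P3 E <= #|N| -> (forall x, #|nbhd E x| <= #|N|) ->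
  #|N| != 2 ->
  2 * (\sum_(u in N) #|nbhd E u :\: (v |: N)|) <=
    (\sum_(u in N) #|N :\ u :\: nbhd E u|).+1.
Proof.
move=> sE exE maxN N2.
pose D u := #|nbhd E u :\: (v |: N)|; pose M u := #|N :\ u :\: nbhd E u|.
rewrite -[X in 2 * X]/(\sum_(u in N) D u) -[X in _ <= X.+1]/(\sum_(u in N) M u).
have DM u : u \in N -> D u <= M u.
  move=> uN; have := degree_nonneighbours sE uN; have := maxN u.
  by rewrite -/N -/(D u) -/(M u); clear; lia.
have D1 u : u \in N -> D u <= 1.
  move=> uN; have := outside_bound sE uN; move: exE; rewrite -/N -/(D u).
  by clear; lia.
(* Without such a [u], [2 * D u <= M u] holds for every [u] in [N]. *)
have [/exists_inP[u uN /andP[Du Mu]]|] :=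
    boolP [exists u in N, (D u == 1) && (M u <= 1)]; last first.
  rewrite negb_exists_in => /forall_inP DM2; apply: leqW.
  rewrite big_distrr /=; apply: leq_sum => u uN; have := DM2 u uN.
  by move: (D1 u uN) (DM u uN); clear; lia.
have M1 : M u == 1 by move: Du Mu (DM u uN); clear; lia.
have /cards1P[w missE] := M1.
have /setDP[/setD1P[wu wN] uw] : w \in N :\ u :\: nbhd E u.
  by rewrite missE set11.
have [x xS] : exists x, x \in nbhd E u :\: (v |: N).
  by apply/set0Pn; rewrite -card_gt0 -/(D u) (eqP Du).
have w_isolated z : z \in N :\ w -> z \notin nbhd E w.
  case/setD1P => zw zN; have [->|zu] := eqVneq z u; first by rewrite nbhd_sym.
  exact: lone_nonneighbour uN zN missE xS zu zw.
have cNw : #|N| = (#|N :\ w|).+1 by rewrite (cardsD1 w) wN.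
have Mw : #|N :\ w| <= M w.
  by apply/subset_leq_card/subsetP => z zNw; rewrite inE w_isolated.
have wM z : z \in N :\ w -> w \in N :\ z :\: nbhd E z.
  move=> zNw; case/setD1P: (zNw) => zw _.
  by rewrite in_setD nbhd_sym w_isolated // in_setD1 eq_sym zw.
have M_gt0 z : z \in N :\ w -> 1 <= M z.
  by move=> /wM wz; apply/card_gt0P; exists w.
rewrite [X in _ <= X.+1](big_setD1 w wN) /=.
have sumM1 (A : {set T}) : A \subset N :\ w -> #|A| <= \sum_(z in A) M z.
  by move=> /subsetP sA; rewrite -sum1_card; apply: leq_sum => z /sA /M_gt0.
have sumD1 (A : {set T}) : A \subset N -> \sum_(z in A) D z <= #|A|.
  by move=> /subsetP sA; rewrite -sum1_card; apply: leq_sum => z /sA /D1.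
(* Now [2 * sum D <= 2 * #|N|], while [sum M + 1 >= 2 * #|N| - 1]: one unit is lacking, and any [z]
   with [D z = 0], or [z != w] with [M z > 1], supplies it. *)
have [allD|] := boolP [forall z in N, D z == 1]; last first.
  rewrite negb_forall_in => /exists_inP[z zN Dz].
  have := sumD1 _ (subsetDl N [set z]); have := sumM1 _ (subxx _).
  rewrite (big_setD1 z zN) /=; move: (D1 z zN) Dz Mw cNw (cardsD1 z N).
  by rewrite zN; clear; lia.
have [allM|] := boolP [forall z in N :\ w, M z == 1]; last first.
  rewrite negb_forall_in => /exists_inP[z zN Mz].
  have := sumD1 _ (subxx N); have := sumM1 _ (subsetDl _ [set z]).
  rewrite (big_setD1 z zN) /=; move: (M_gt0 z zN) Mz Mw cNw (cardsD1 z (N :\ w)).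
  by rewrite zN; clear; lia.
(* In the remaining configuration [u] and a third vertex [z] both miss only [w], hence are adjacent,
   and both share the outside neighbour of [w]. *)
have [z] : exists z, z \in N :\ w :\ u.
  apply/set0Pn; rewrite -card_gt0; move: N2 cNw (cardsD1 u (N :\ w)).
  by rewrite in_setD1 uN (eq_sym u w) wu /=; clear; lia.
case/setD1P => zu zNw; case/setD1P: (zNw) => zw zN.
have missz : N :\ z :\: nbhd E z = [set w].
  have /cards1P[w' Ew'] : M z == 1 by apply: (forall_inP allM).
  by have := wM z zNw; rewrite Ew' => /set1P ->.
have out t : t \in N -> exists y, y \in nbhd E t :\: (v |: N).
  move=> tN; apply/set0Pn; rewrite -card_gt0 -/(D t).
  by rewrite (eqP (forall_inP allD _ tN)).
have [y yS] := out z zN; have [y' y'S] := out w wN.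
have xy' := lone_nonneighbour_outside sE exE uN missE xS y'S.
have yy' := lone_nonneighbour_outside sE exE zN missz yS y'S.
have uz : z \in nbhd E u.
  by apply: (subsetP (nbhd_lone_nonneighbour missE)); rewrite !in_setD1 zw zu.
by have := outside_disjoint sE exE uN zN uz xS; rewrite -/N xy' -yy' yS.
Qed.

(** * The induction for the upper bound *)

Lemma mul2_bin2S m : 2 * 'C(m.+1, 2) = m.+1 * m.
Proof. by rewrite -mul_bin_diag bin1. Qed.

Lemma ex_P3_card_edges m E :
  simple_graph E -> ex_P3 E <= m -> #|E| <= 'C(m.+1, 2) + (m == 2).
Proof.
elim/ltn_ind: m E => m IH E sE exE.
have [->|/set0Pn[e eE]] := eqVneq E set0; first by rewrite cards0.
have /eqP /cards2P[a [b [_ eab]]] := simple_graphP _ sE e eE.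
(* The default [a] lies on an edge, so the maximum degree is positive and the induction hypothesis
   applies to [m - #|N|]. *)
pose v := [arg max_(x > a) #|nbhd E x|].
have maxv x : #|nbhd E x| <= #|nbhd E v|.
  by rewrite /v; case: arg_maxnP => // i _ /(_ x isT).
set N := nbhd E v in maxv *.
have N_gt0 : 0 < #|N|.
  apply: leq_trans (maxv a); apply/card_gt0P; exists b.
  by rewrite in_nbhd -eab.
have vN : v \notin N by apply/negP => /(nbhd_neq sE); rewrite eqxx.
pose S := ~: (v |: N).
have exS : ex_P3 (E ::&: S) + #|N| <= m.
  apply: leq_trans exE; rewrite addnC.
  have dis : [disjoint v |: N & S] by rewrite -setI_eq0 setICr.
  apply: leq_trans (ex_P3_superadd sE dis); rewrite leq_add2r.
  exact: ex_P3_star.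
have cES : #|E ::&: S| <= 'C((m - #|N|).+1, 2) + (m - #|N| == 2).
  apply: IH; first by move: exS N_gt0; clear; lia.
    exact: simple_graphS (induced_sub _ _) sE.
  by move: exS; clear; lia.
have := double_count_edges (v |: N) sE; rewrite -/S big_setU1 //= -/N.
have -> : #|N :\: (v |: N)| = 0.
  by apply/eqP; rewrite cards_eq0 setD_eq0 subsetUr.
rewrite addn0 => dc.
have bm := mul2_bin2S m; have br := mul2_bin2S (m - #|N|).
have [r0|r_gt0] := posnP (m - #|N|); last first.
  have sum : \sum_(x in N) (#|nbhd E x| + #|nbhd E x :\: (v |: N)|)
      <= #|N| * (#|N| + (m - #|N|).+1).
    rewrite -sum_nat_const; apply: leq_sum => u uN.
    have := outside_bound sE uN; have := maxv u; move: exE exS; rewrite -/N.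
    by clear; lia.
  move: r_gt0 N_gt0 cES dc bm br sum.
  have -> : m = (m - #|N|) + #|N| by move: exS; clear; lia.
  rewrite addnK; move: (m - #|N|) => r; move: #|N| => d.
  move: (\sum_(x in N) _) #|E| #|E ::&: S| ('C(_, 2)) ('C(_, 2)) => s e1 e2 c1 c2.
  (* On the doubled scale the margin is [d * (r - 1)]. At [r = 2] it must pay for the exceptional
     edge, which costs 2; for [d = 1] parity supplies the missing unit. *)
  clear; case: (r =P 2) => [->|r2]; case: eqP => ? /=; nia.
have mN : #|N| = m by move: r0 exS; clear; lia.
have ES0 : E ::&: S = set0.
  apply: ex_P3_eq0; first exact: simple_graphS (induced_sub _ _) sE.
  by move: exS mN; clear; lia.
rewrite ES0 cards0 in dc.
rewrite -mN in exE.
have sumdeg : \sum_(x in N) (#|nbhd E x| + #|nbhd E x :\: (v |: N)|)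
    + \sum_(x in N) #|N :\ x :\: nbhd E x|
    = m * m + 2 * \sum_(x in N) #|nbhd E x :\: (v |: N)|.
  rewrite -{1}mN -mN -sum_nat_const big_distrr -!big_split /=.
  apply: eq_bigr => u uN; have := degree_nonneighbours sE uN; rewrite -/N.
  by clear; lia.
(* For [m = 2], [2 e(G) <= 6 + sumD <= 8], attained by the 4-cycle. *)
have [m2|m2] := eqVneq m 2.
  have sumD : \sum_(x in N) #|nbhd E x :\: (v |: N)|
      <= \sum_(x in N) #|N :\ x :\: nbhd E x|.
    apply: leq_sum => u uN; have := degree_nonneighbours sE uN; have := maxv u.
    by rewrite -/N; clear; lia.
  have sumD2 : \sum_(x in N) #|nbhd E x :\: (v |: N)| <= 2.
    rewrite -m2 -mN -sum1_card; apply: leq_sum => u uN.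
    by have := outside_bound sE uN; move: exE; rewrite -/N; clear; lia.
  rewrite m2 in bm sumdeg mN *; rewrite mN in dc.
  by move: dc bm sumdeg sumD sumD2; clear; lia.
have := sum_nonneighbours sE exE maxv; rewrite mN m2 => /(_ isT).
rewrite mN in dc; move: dc bm sumdeg; rewrite -/N /= addn0.
move: (\sum_(x in N) _) (\sum_(x in N) _) (\sum_(x in N) _) #|E| ('C(_, 2)).
clear; nia.
Qed.

End Graphs.

(** * The extremal graphs *)

(* The hypotheses are those satisfied by a subgraph of a graph obtained from a
   graph on [X] by attaching at most one pendant edge at every vertex; they
   survive deleting the edges at a vertex [x] and moving [x] out of [X]. *)
Lemma P3_free_card_core (T : finType) (F : {set {set T}}) (X : {set T}) :
  simple_graph F -> ~~ has_P3 F ->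
  (forall x y, y \in nbhd F x -> (x \in X) || (y \in X)) ->
  (forall y, y \notin X -> #|nbhd F y| <= 1) ->
  (forall x, x \in X -> #|nbhd F x :\: X| <= 1) ->
  #|F| <= #|X|.
Proof.
have [n] := ubnP #|X|; elim: n => // n IH in X F *; rewrite ltnS => leXn.
move=> sF nF meetX degout pend.
(* A vertex of [X] of degree at most one is deleted with its edge, costing one vertex and at most
   one edge. *)
have [/exists_inP[x xX degx]|] := boolP [exists x in X, #|nbhd F x| <= 1].
  pose F' := [set e in F | x \notin e].
  have sF'F : F' \subset F by apply/subsetP => e; rewrite inE => /andP[].
  have nbx y : x \notin nbhd F' y by rewrite !inE eqxx orbT andbF.
  have cX : #|X| = (#|X :\ x|).+1 by rewrite (cardsD1 x) xX.
  have cF : #|F| = #|nbhd F x| + #|F'|.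
    rewrite card_nbhd // -(cardsID [set e : {set T} | x \in e] F).
    by congr (_ + _); apply: eq_card => e; rewrite !inE // andbC.
  rewrite cF cX -add1n leq_add //; apply: IH.
  - by rewrite -cX.
  - exact: simple_graphS sF.
  - apply: contra nF => /has_P3P[a [b [c [d [u ab bc cd]]]]].
    by apply/has_P3P; exists a, b, c, d; split=> //; apply: (subsetP sF'F).
  - move=> y z yz; have zx : z != x by apply: contraTneq yz => ->.
    have yx : y != x by apply: contraTneq yz => ->; rewrite nbhd_sym.
    by rewrite !in_setD1 yx zx meetX // (subsetP (nbhdS _ sF'F)).
  - move=> y; rewrite in_setD1 negb_and negbK => /orP[/eqP->|yX].
      by rewrite (_ : nbhd F' x = set0) ?cards0 //; apply/setP => z;
         rewrite nbhd_sym in_set0; apply/negbTE.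
    exact: leq_trans (subset_leq_card (nbhdS y sF'F)) (degout y yX).
  - move=> y /setD1P[_ yX]; apply: leq_trans (pend y yX).
    apply/subset_leq_card/subsetP => z /setDP[yz]; rewrite in_setD1 negb_and.
    rewrite negbK => /orP[/eqP zx|zX]; first by move: (nbx y); rewrite -zx yz.
    by rewrite in_setD zX (subsetP (nbhdS _ sF'F)).
rewrite negb_exists_in => /forall_inP deg2.
have {}deg2 x : x \in X -> 1 < #|nbhd F x| by move=> /deg2; rewrite -ltnNge.
(* All degrees in [X] are now at least 2. By [pend], [x] has a neighbour [a] in [X], which has a
   further neighbour [d]; another neighbour [b] of [x] would give the path [d a x b]. So [x], [a],
   [d] form a triangle, and [d] has degree above one, hence lies in [X]. *)
have nb2 x : x \in X -> #|nbhd F x| <= 2 /\ nbhd F x \subset X.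
  move=> xX.
  have [a] : exists a, a \in nbhd F x :&: X.
    apply/set0Pn; rewrite -card_gt0; move: (deg2 x xX) (pend x xX).
    by rewrite -(cardsID X (nbhd F x)); clear; lia.
  case/setIP => xa aX.
  have ax : x \in nbhd F a by rewrite nbhd_sym.
  have [d] : exists d, d \in nbhd F a :\ x.
    apply/set0Pn; rewrite -card_gt0; move: (deg2 a aX).
    by rewrite (cardsD1 x (nbhd F a)) ax; clear; lia.
  case/setD1P => dx ad.
  have sub : nbhd F x \subset [set a; d].
    apply/subsetP => b xb; apply: contraNT nF; rewrite !inE negb_or => /andP[ba bd].
    apply/has_P3P; exists d, a, x, b; split; rewrite -?in_nbhd // 1?nbhd_sym //.
    rewrite /= !inE !negb_or dx (eq_sym d a) (nbhd_neq sF ad) (eq_sym d b) bd.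
    by rewrite (eq_sym a x) (nbhd_neq sF xa) (eq_sym a b) ba (nbhd_neq sF xb).
  split; first by rewrite (leq_trans (subset_leq_card sub)) // cards2; case: (_ != _).
  rewrite (subset_trans sub) // subUset !sub1set aX /=.
  have xd : d \in nbhd F x.
    apply: contraLR (deg2 x xX) => xd; rewrite -leqNgt -(cards1 a).
    apply/subset_leq_card/subsetP => b xb; move: (subsetP sub b xb).
    by rewrite !inE => /orP[//|/eqP bd]; rewrite -bd xb in xd.
  apply: contraT => /degout; rewrite leqNgt => /negP[].
  rewrite (_ : 2 = #|[set a; x]|); last by rewrite cards2 eq_sym (nbhd_neq sF xa).
  by apply/subset_leq_card; rewrite subUset !sub1set !(nbhd_sym F d) ad xd.
(* Degrees are at most 2 on [X] and 0 elsewhere, so the degree sum is at most [2 * #|X|]. *)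
rewrite -(leq_pmul2l (isT : 0 < 2)) -handshake // (bigID (mem X)) /=.
rewrite [X in _ + X]big1 ?addn0 => [|y yX].
  by rewrite mulnC -sum_nat_const leq_sum // => x /nb2[].
apply/eqP; rewrite cards_eq0; apply/eqP/setP => x; rewrite in_set0.
apply/negbTE; apply: contra yX => yx; have := meetX _ _ yx.
by case/orP=> // xX; apply: (subsetP (nb2 x xX).2); rewrite nbhd_sym.
Qed.

(** * The clique with pendant edges *)

Section Corona.

Variable m : nat.

(** [inl i] is a clique vertex and [inr i] the leaf attached to it. *)
Definition corona_core : {set 'I_m + 'I_m} := [set inl i | i : 'I_m].

Definition corona_clique : {set {set 'I_m + 'I_m}} :=
  [set e : {set 'I_m + 'I_m} | e \subset corona_core & #|e| == 2] :|:
  [set [set inl i; inr i] | i : 'I_m].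

Lemma in_corona_core_inl i : inl i \in corona_core.
Proof. exact: imset_f. Qed.

Lemma in_corona_core_inr i : inr i \in corona_core = false.
Proof. by apply/imsetP => -[]. Qed.

Lemma card_corona_core : #|corona_core| = m.
Proof. by rewrite card_imset ?card_ord // => i j []. Qed.

Lemma corona_clique_simple : simple_graph corona_clique.
Proof.
apply/simple_graphP => e; rewrite !inE => /orP[/andP[_ /eqP]//|/imsetP[i _ ->]].
by rewrite cards2.
Qed.

Lemma card_corona_clique : #|corona_clique| = 'C(m.+1, 2).
Proof.
rewrite cardsU (_ : _ :&: _ = set0) ?cards0 ?subn0; last first.
  apply/setP => e; rewrite !inE; apply/negP => /andP[/andP[/subsetP eX _]].
  move=> /imsetP[i _ eE]; have := eX (inr i).
  by rewrite eE in_corona_core_inr !inE eqxx orbT => /(_ isT).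
rewrite cards_draws card_corona_core card_imset ?card_ord; last first.
  by move=> i j /setP/(_ (inl i)); rewrite !inE eqxx => /esym/orP[/eqP[]|/eqP].
(* Pascal's rule: ['C(m, 2)] clique edges and [m] pendant ones. *)
by rewrite binS bin1.
Qed.

Lemma corona_nbhd_inr i x : x \in nbhd corona_clique (inr i) -> x = inl i.
Proof.
rewrite !inE subUset sub1set in_corona_core_inr /= => /imsetP[j _ /setP eE].
have := eE (inr i); have := eE x; have := eE (inl j).
by rewrite !inE !eqxx orbT /= => /eqP <- _ /esym/eqP[->].
Qed.

Lemma ex_P3_corona_clique : ex_P3 corona_clique <= m.
Proof.
have [F [sF nF <-]] := ex_P3_attained corona_clique.
rewrite -[leqRHS]card_corona_core; apply: P3_free_card_core => //.
- exact: simple_graphS corona_clique_simple.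
- move=> [i|i] y; rewrite ?in_corona_core_inl // => /(subsetP (nbhdS _ sF)).
  by move=> /corona_nbhd_inr ->; rewrite in_corona_core_inl orbT.
- move=> [i|i]; rewrite ?in_corona_core_inl // => _.
  rewrite -(cards1 (@inl _ 'I_m i)); apply/subset_leq_card/subsetP => x.
  by move=> /(subsetP (nbhdS _ sF)) /corona_nbhd_inr ->; rewrite set11.
- move=> [i|i]; rewrite ?in_corona_core_inr // => _.
  rewrite -(cards1 (@inr 'I_m _ i)); apply/subset_leq_card/subsetP => -[j|j].
    by rewrite inE in_corona_core_inl.
  rewrite in_setD nbhd_sym => /andP[_ /(subsetP (nbhdS _ sF))].
  by move=> /corona_nbhd_inr[->]; rewrite set11.
Qed.

End Corona.

(** * The 4-cycle *)

Definition square_edge (p : bool * bool) : {set bool + bool} :=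
  [set inl p.1; inr p.2].

(** The 4-cycle as [K_{2,2}], so that pairs of booleans index its edges. *)
Definition square : {set {set bool + bool}} := [set square_edge p | p : bool * bool].

Lemma square_edge_inj : injective square_edge.
Proof.
move=> [a b] [c d] /setP eE; have := eE (inl a); have := eE (inr b).
by rewrite !inE !eqxx /= orbF => /esym/eqP[->] /esym/eqP[->].
Qed.

Lemma square_simple : simple_graph square.
Proof. by apply/simple_graphP => _ /imsetP[p _ ->]; rewrite cards2. Qed.

Lemma card_square : #|square| = 4.
Proof. by rewrite (card_imset _ square_edge_inj) card_prod card_bool. Qed.

(* Three of the four edges always form a path. *)
Lemma ex_P3_square : ex_P3 square <= 2.
Proof.
have [F [sF nF <-]] := ex_P3_attained square; rewrite leqNgt.
apply: contra nF => F3.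
have : #|square :\: F| <= 1.
  by move: F3; rewrite cardsD (setIidPr sF) card_square; clear; lia.
(* [q] indexes the only edge that may be missing; if none is, any pair serves. *)
have [q qF] : exists q, #|square :\: F| <= 1 -> forall p, p != q -> square_edge p \in F.
  have [/existsP[q qF]|nq] := boolP [exists q, square_edge q \notin F].
    exists q => /card_le1_eqP eq1 p pq; apply: contraNT pq => pF; apply/eqP.
    by apply: square_edge_inj; apply: eq1; rewrite in_setD ?pF ?qF imset_f.
  exists (true, true) => _ p _; move: nq; rewrite negb_exists => /forallP/(_ p).
  by rewrite negbK.
move=> /qF {}qF; case: q qF => a b qF; apply/has_P3P.
(* This path runs through the three edges other than [(a, b)]. *)
exists (inl a), (inr (~~ b)), (inl (~~ a)), (inr b); split.
- by case: a b {qF} => -[].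
- by apply: (qF (a, ~~ b)); case: a b {qF} => -[].
- by rewrite setUC; apply: (qF (~~ a, ~~ b)); case: a b {qF} => -[].
- by apply: (qF (~~ a, b)); case: a b {qF} => -[].
Qed.

(* First conjunct: the bound e(G) <= C(k,2) + 1_{k=3}.
   Second conjunct together with the first: E_{P_3}(k) = C(k,2) + 1_{k=3}
   (the sup of a bounded set of naturals is attained). *)
Theorem theorem3p14 (k : nat) (hk : 0 < k) :
  (forall (T : finType) (E : {set {set T}}),
      simple_graph E -> ex_P3 E < k -> #|E| <= 'C(k, 2) + (k == 3)) /\
  (exists (T : finType) (E : {set {set T}}),
      [/\ simple_graph E, ex_P3 E < k & #|E| = 'C(k, 2) + (k == 3)]).
Proof.
case: k hk => // m _; split=> [T E sE|].
  by rewrite ltnS eqSS; apply: ex_P3_card_edges.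
have [->|m2] := eqVneq m 2.
  exists (bool + bool)%type, square; split; first exact: square_simple.
    by rewrite ltnS ex_P3_square.
  by rewrite card_square.
exists ('I_m + 'I_m)%type, (corona_clique m); split.
- exact: corona_clique_simple.
- by rewrite ltnS ex_P3_corona_clique.
- by rewrite card_corona_clique eqSS (negPf m2) addn0.
Qed.
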